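(* Let $f:\mathbb{Z}\to\mathbb{R}$ be a strictly increasing function. Then for any integers $a,\widehat{a},\alpha,\widehat{\alpha}$ we have $$ \left(\widehat{\alpha}-\widehat{a}\right)\left[f(\widehat{a}-1)-f(\widehat{\alpha})\right] \le \sum_{t=\widehat{a}}^{a-1} f(t) - \sum_{t=\widehat{\alpha}}^{\alpha-1} f(t) + (\alpha-a)f(\alpha) + (\widehat{a}-\widehat{\alpha})f(\widehat{\alpha}) \le \left(\alpha-a\right)\left[f(\alpha)-f(a-1)\right], $$ where the equalities hold if and only if $\widehat{\alpha}\in\{\widehat{a}-1,\widehat{a}\}$ and $\alpha\in\{a-1,a\}$.
   Context: Sums are oriented as integrals: for integers $r,s$, $\sum_{t=r}^{s-1}f(t)$ is the usual sum if $r<s$, is $0$ if $r=s$, and means $-\sum_{t=s}^{r-1}f(t)$ if $s<r$. *)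

(* Defs.v *)
From mathcomp Require Import all_boot all_order all_algebra.
From mathcomp Require Import reals.

Set Implicit Arguments.
Unset Strict Implicit.
Unset Printing Implicit Defensive.

Import Order.TTheory GRing.Theory Num.Theory.
Local Open Scope ring_scope.

(* For r <= s this is f r + f (r + 1) + ... + f (s - 1); the number of terms
   s - r is read as a natural number through the absolute value. *)
Definition sum_int (V : zmodType) (f : int -> V) (r s : int) : V :=
  \sum_(k < `|s - r|%N) f (r + k%:Z).

(* Sum oriented as an integral; for r = s the first branch is the empty sum. *)
Definition oriented_sum (V : zmodType) (f : int -> V) (r s : int) : V :=
  if r <= s then sum_int f r s else - sum_int f s r.

Notation "\osum_ ( r <= t < s ) F" := (oriented_sum (fun t : int => F) r s)
  (at level 41, F at level 41, r, t, s at level 50,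
   format "'[' \osum_ ( r  <=  t  <  s ) '/  '  F ']'") : ring_scope.

(* Main.v *)
(** Put G(c, x) = (x - c) f(x) - sum_(c <= t < x) f(t), the oriented sum of
    f(x) - f(t). The middle quantity is G(a, alpha) - G(ahat, alphahat), and
    0 <= G(c, x) <= (x - c) (f(x) - f(c - 1)): the two gaps are the oriented
    sums of f(x) - f(t) and of f(t) - f(c - 1). In both sums the terms are
    positive when c <= t < x, and nonpositive when x <= t < c with a single
    zero (at t = x, resp. at t = c - 1), so both gaps vanish exactly for
    x = c - 1 and x = c. *)
Require Import Defs.
From mathcomp Require Import all_boot all_order all_algebra.
From mathcomp Require Import reals.
From mathcomp Require Import zify lra.

Import Order.TTheory GRing.Theory Num.Theory.
Local Open Scope ring_scope.

Lemma oriented_sumB (V : zmodType) (g h : int -> V) (r s : int) :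
  \osum_(r <= t < s) (g t - h t)
  = \osum_(r <= t < s) g t - \osum_(r <= t < s) h t.
Proof.
by rewrite /oriented_sum /sum_int; case: ifP => _; rewrite sumrB ?opprD.
Qed.

Lemma oriented_sum_const (R : nzRingType) (k : R) (r s : int) :
  \osum_(r <= t < s) k = (s - r)%:~R * k.
Proof.
rewrite /oriented_sum /sum_int; case: ifP => rs;
  rewrite sumr_const card_ord -mulr_natl.
- by congr (_ * _); rewrite pmulrn; congr (_%:~R); lia.
- rewrite -mulNr; congr (_ * _); rewrite pmulrn -mulrNz.
  by congr (_%:~R); lia.
Qed.

Lemma subr_leif0 (R : numDomainType) (x y : R) (C : bool) :
  (0 <= y - x ?= iff C) = (x <= y ?= iff C).
Proof. by rewrite leifBRL add0r. Qed.

Lemma sum_int_Chasles (V : zmodType) (f : int -> V) (m r s : int) :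
  m <= r -> r <= s -> sum_int f m s = sum_int f m r + sum_int f r s.
Proof.
move=> mr rs; rewrite /sum_int.
have -> : `|s - m|%N = (`|r - m| + `|s - r|)%N by lia.
rewrite big_split_ord /=; congr (_ + _); apply: eq_bigr => k _.
by congr f; lia.
Qed.

(** A base point below both bounds plays the part of the origin of an antiderivative, which removes
    the case split on the order of the bounds. *)
Lemma oriented_sum_sum_int (V : zmodType) (f : int -> V) (m r s : int) :
  m <= r -> m <= s -> oriented_sum f r s = sum_int f m s - sum_int f m r.
Proof.
move=> mr ms; rewrite /oriented_sum; case: ifP => rs.
- by rewrite (@sum_int_Chasles _ f _ _ _ mr rs) addrC addKr.
- have sr : s <= r by lia.
  by rewrite (@sum_int_Chasles _ f _ _ _ ms sr) opprD addNKr.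
Qed.

Lemma oriented_sum_Chasles (V : zmodType) (f : int -> V) (r s u : int) :
  oriented_sum f r s + oriented_sum f s u = oriented_sum f r u.
Proof.
(* With one base point below all three bounds, the identity telescopes. *)
pose m := Num.min r (Num.min s u).
have [mr ms mu] : [/\ m <= r, m <= s & m <= u].
  by rewrite /m !ge_min !lexx !orbT.
by rewrite !(@oriented_sum_sum_int _ f m) // addrC addrA subrK.
Qed.

(** Treats both gaps at once, [e] being the only zero of [h] on the reversed range. A reversed sum
    of nonpositive terms vanishes only if each index is [e], which forces a range of length one. *)
Lemma oriented_sum_leif (R : numDomainType) (h : int -> R) (c x e : int) :
    (forall t, c <= t < x -> 0 < h t) ->
    (forall t, x <= t < c -> h t <= 0 ?= iff (t == e)) ->
    (x < c -> x <= e < c) ->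
  0 <= \osum_(c <= t < x) h t ?= iff ((x == c - 1) || (x == c)).
Proof.
move=> h_gt0 h_le0 e_in; rewrite /oriented_sum /sum_int; case: ifP => cx.
- have /leif_sum : forall k : 'I_(`|x - c|%N), true ->
      0 <= h (c + k%:Z) ?= iff false.
    move=> k _; have := ltn_ord k => k_lt.
    have h0 : 0 < h (c + k%:Z) by apply: h_gt0; lia.
    by split; rewrite ?ltW // lt_eqF.
  rewrite sumr_const mul0rn => -[le_sum eq_sum]; split => //.
  rewrite eq_sum; apply/forallP/idP => [no_term|x_eq k].
  + case: (eqVneq x c) => [|x_neq]; first by rewrite orbT.
    have x_gt : (0 < `|x - c|%N)%N by lia.
    by have := no_term (Ordinal x_gt).
  + by have := ltn_ord k; lia.
- have /leif_sum : forall k : 'I_(`|c - x|%N), true ->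
      h (x + k%:Z) <= 0 ?= iff (x + k%:Z == e).
    by move=> k _; apply: h_le0; have := ltn_ord k; lia.
  rewrite sumr_const mul0rn => -[le_sum eq_sum]; split; first by rewrite oppr_ge0.
  rewrite eq_sym oppr_eq0 eq_sum; apply/forallP/idP => [all_e|x_eq k].
  + case: (eqVneq x (c - 1)) => //= x_neq.
    (* Here [x < c - 1], so the indices [x] and [x + 1] both occur and cannot both be [e]. *)
    have lt0 : (0 < `|c - x|%N)%N by lia.
    have lt1 : (1 < `|c - x|%N)%N by lia.
    by have := all_e (Ordinal lt0); have := all_e (Ordinal lt1) => /=; lia.
  + by have := ltn_ord k; have := e_in; lia.
Qed.

Lemma oriented_sum_leif_right (R : numDomainType) (f : int -> R)
    (f_incr : {homo f : x y / x < y}) (c x : int) :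
  \osum_(c <= t < x) f t <= (x - c)%:~R * f x ?= iff ((x == c - 1) || (x == c)).
Proof.
have f_mono := le_mono f_incr.
rewrite -subr_leif0 -oriented_sum_const -oriented_sumB.
apply: (@oriented_sum_leif _ _ _ _ x); last by rewrite lexx => ->.
- by move=> t /andP[_ tx]; rewrite subr_gt0 f_incr.
- move=> t /andP[xt _]; split; first by rewrite subr_le0 f_mono.
  by rewrite subr_eq0 (inj_eq (inc_inj f_mono)) eq_sym.
Qed.

Lemma oriented_sum_leif_left (R : numDomainType) (f : int -> R)
    (f_incr : {homo f : x y / x < y}) (c x : int) :
  (x - c)%:~R * f (c - 1) <= \osum_(c <= t < x) f t
    ?= iff ((x == c - 1) || (x == c)).
Proof.
have f_mono := le_mono f_incr.
rewrite -subr_leif0 -oriented_sum_const -oriented_sumB.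
apply: (@oriented_sum_leif _ _ _ _ (c - 1)); last by lia.
- by move=> t t_in; rewrite subr_gt0 f_incr //; lia.
- move=> t t_in; split; first by rewrite subr_le0 f_mono; lia.
  by rewrite subr_eq0 (inj_eq (inc_inj f_mono)).
Qed.

Theorem theorem3p2 (R : realType) (f : int -> R)
    (f_incr : {homo f : x y / x < y})
    (a ahat alpha alphahat : int) :
  let lower := (alphahat - ahat)%:~R * (f (ahat - 1) - f alphahat) in
  let middle :=
    \osum_(ahat <= t < a) f t - \osum_(alphahat <= t < alpha) f t
    + (alpha - a)%:~R * f alpha + (ahat - alphahat)%:~R * f alphahat in
  let upper := (alpha - a)%:~R * (f alpha - f (a - 1)) in
  let tight := (alphahat = ahat - 1 \/ alphahat = ahat)
               /\ (alpha = a - 1 \/ alpha = a) in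
  [/\ lower <= middle, middle <= upper,
      lower = middle <-> tight & middle = upper <-> tight].
Proof.
move=> lower middle upper tight.
pose gap (c x : int) := (x - c)%:~R * f x - \osum_(c <= t < x) f t.
have middleE : middle = - gap ahat alphahat + gap a alpha.
  (* The sum from [ahat] to [alpha] is split at [a] and at [alphahat]; equating the two splittings
     trades the sums in [middle] for those in the two gaps. *)
  have := oriented_sum_Chasles _ f ahat a alpha.
  have := oriented_sum_Chasles _ f ahat alphahat alpha.
  by rewrite /middle /gap !intrB; lra.
set Phat := (alphahat == ahat - 1) || (alphahat == ahat).
set P := (alpha == a - 1) || (alpha == a).
have tightP : tight <-> Phat && P by rewrite /tight /Phat /P; lia.
have gap_ge0 c x : 0 <= gap c x ?= iff ((x == c - 1) || (x == c)).
  by rewrite subr_leif0; exact: oriented_sum_leif_right.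
have gap_le c x : gap c x <= (x - c)%:~R * (f x - f (c - 1))
    ?= iff ((x == c - 1) || (x == c)).
  (* The summand [(x - c)%:~R * f x] is common to both sides, so its comparison is always tight and
     only the sums decide equality. *)
  rewrite mulrBr; apply: (@leifD _ _ _ true); first exact/leif_refl.
  by rewrite (nmono_leif (@lerN2 R)); exact: oriented_sum_leif_left.
have [lower_le lower_eq] : lower <= middle ?= iff Phat && P.
  (* Written in the shape of [middleE], so that [leifD] pairs the upper bound of the hatted gap with
     the lower bound 0 of the other and conjoins their equality cases. *)
  have -> : lower = - ((alphahat - ahat)%:~R * (f alphahat - f (ahat - 1))) + 0.
    by rewrite addr0 -mulrN opprB.
  by rewrite middleE; apply: leifD; rewrite ?(nmono_leif (@lerN2 R)).
have [upper_le upper_eq] : middle <= upper ?= iff Phat && P.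
  (* The bounds swap roles: 0 for the hatted gap, the upper bound for the other. *)
  rewrite middleE (_ : upper = - 0 + upper); last by rewrite oppr0 add0r.
  by apply: leifD; rewrite ?(nmono_leif (@lerN2 R)).
split=> //; rewrite tightP.
- by rewrite -lower_eq; split=> /eqP.
- by rewrite -upper_eq; split=> /eqP.
Qed.
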